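(* Let $\kappa\ge 0$ and $\tau>0$. Let $(Q_h^n,s^n)_{n\ge 0}\subset \mathbf S_h^{(3)}\times\mathbb R$ be generated by the sESAV1 scheme, i.e. $(Q_h^{n+1},s^{n+1})=\mathrm{sESAV1}(Q_h^n,s^n,\tau)$ for all $n\ge0$, starting from $Q_h^0\in\mathbf S_h^{(3)}$ and $s^0=\mathcal E_{1h}[Q_h^0]$. Then the scheme is unconditionally energy stable in the sense that $$E_h[Q_h^{n+1},s^{n+1}]\le E_h[Q_h^n,s^n],\qquad n\ge 0 .$$
   Context: Parameters: $a\in\mathbb R$, $b\ge0$, $c>0$, $L_1,L_2,L_3>0$. Domain $\Omega=[0,L_d]^3$ with $L_d>0$, mesh size $h=L_d/M$ with $M$ a positive integer. Grid functions. $\mathbf E_h^0$ is the set of real functions $U=(U_{p,q,r})_{0\le p,q,r\le M}$ that vanish when any index equals $0$ or $M$ (homogeneous Dirichlet condition). They are extended by zero to ghost nodes with index $-1$ or $M+1$. $\mathbf S_h^{(3)}$ is the set of symmetric, trace-free $3\times3$ arrays $\Phi_h=(\Phi_h^{ij})$ with $\Phi_h^{ij}\in\mathbf E_h^0$ (i.e. $\Phi_h^{ij}=\Phi_h^{ji}$, $\sum_i\Phi_h^{ii}=0$). Difference operators. $D_k^+$ is the forward difference in direction $k$ (e.g. $(D_1^+U)_{p+1/2,q,r}=(U_{p+1,q,r}-U_{p,q,r})/h$), and $D_k^c$ is the centered difference in direction $k$ (e.g. $(D_1^cU)_{p,q,r}=(U_{p+1,q,r}-U_{p-1,q,r})/(2h)$),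 and $D_{kl}^c=D_k^cD_l^c$. $\Delta_h$ is the standard seven-point discrete Laplacian. Inner products and norms. $\langle U,V\rangle_h=h^3\sum_{p,q,r=0}^{M}U_{p,q,r}V_{p,q,r}$ and $\|U\|_h^2=\langle U,U\rangle_h$. $\|\nabla_hU\|_h^2=\sum_{k=1}^3\|D_k^+U\|^2$, where $\|D_k^+U\|^2$ is $h^3$ times the sum of squares of $D_k^+U$ over all edges of the grid in direction $k$. For $\Phi_h\in\mathbf S_h^{(3)}$: $\|\Phi_h\|_h^2=\sum_{i,j}\|\Phi_h^{ij}\|_h^2$ and $\|\nabla_h\Phi_h\|_h^2=\sum_{i,j}\|\nabla_h\Phi_h^{ij}\|_h^2$. Nonlinearity (evaluated at each grid point): $f(Q^{ij})=-aQ^{ij}+b\big((Q^2)^{ij}-\tfrac13\operatorname{tr}(Q^2)\delta^{ij}\big)-c\operatorname{tr}(Q^2)Q^{ij}$. Energies. With $\mathcal F_{\rm bulk}(Q)=\frac a2\operatorname{tr}(Q^2)-\frac b3\operatorname{tr}(Q^3)+\frac c4\operatorname{tr}^2(Q^2)$, set $\mathcal E_{1h}[Q_h]=\langle\mathcal F_{\rm bulk}(Q_h),1\rangle_h$ and $$E_{el}[Q_h]=\tfrac{L_1}{2}\|\nabla_hQ_h\|_h^2+\tfrac{L_2+L_3}{2}\sum_{i=1}^3\Big\|\sum_{k=1}^3D_k^cQ_h^{ik}\Big\|_h^2,\qquad E_h[Q_h,s]=E_{el}[Q_h]+s .$$ $C_*>0$ is a fixed constant such that $|\Omega|\,\mathcal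 F_{\rm bulk}(A)\ge -C_*$ for every symmetric trace-free $A\in\mathbb R^{3\times3}$ (so $\mathcal E_{1h}\ge -C_*$ on $\mathbf S_h^{(3)}$). Set $g(Q_h,s)=\exp\{s\}/\exp\{\mathcal E_{1h}[Q_h]\}$. Operator: $\mathcal D_h^cQ_h^{ij}=\sum_{k=1}^3\big(D_{jk}^cQ_h^{ik}+D_{ik}^cQ_h^{jk}\big)-\frac23\sum_{k,l=1}^3D_{lk}^cQ_h^{lk}\,\delta^{ij}$. Scheme. For $(Q_h^n,s^n)\in\mathbf S_h^{(3)}\times\mathbb R$, step $\tau>0$ and stabilizing constant $\kappa\ge0$, $(Q_h^{n+1},s^{n+1})=\mathrm{sESAV1}(Q_h^n,s^n,\tau)\in\mathbf S_h^{(3)}\times\mathbb R$ is defined by, for $i,j=1,2,3$ at all interior grid points, $$\frac{Q_h^{ij,n+1}-Q_h^{ij,n}}{\tau}=L_1\Delta_hQ_h^{ij,n+1}+\frac{L_2+L_3}{2}\mathcal D_h^cQ_h^{ij,n+1}+g(Q_h^n,s^n)\big(f(Q_h^{ij,n})-\kappa(Q_h^{ij,n+1}-Q_h^{ij,n})\big),$$ $$\frac{\tilde s^{n+1}-s^n}{\tau}=-g(Q_h^n,s^n)\sum_{i,j=1}^3\Big\langle f(Q_h^{ij,n}),\frac{Q_h^{ij,n+1}-Q_h^{ij,n}}{\tau}\Big\rangle_h,\qquad s^{n+1}=\max\{\tilde s^{n+1},-C_*-E_{el}[Q_h^{n+1}]\}.$$ *)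

(* Defs.v *)
From mathcomp Require Import all_boot all_order all_algebra.
From mathcomp Require Import reals sequences exp.

Set Implicit Arguments.
Unset Strict Implicit.
Unset Printing Implicit Defensive.

Import Order.TTheory GRing.Theory Num.Theory.
Local Open Scope ring_scope.

(* A node (p, q, r) of the grid {0, ..., M}^3 is a row vector of ordinals; the
   coordinate in direction k is [p ord0 k]. *)
Definition node (M : nat) : Type := 'rV['I_M.+1]_3.

(* All real functions on the nodes; the Dirichlet condition is [dirichlet]. *)
Notation gridfun R M := {ffun 'rV['I_M.+1]_3 -> R}.

Definition dirichlet {R : realType} {M : nat} (U : gridfun R M) : Prop :=
  forall p : node M,
    (exists k : 'I_3, p ord0 k = 0%N :> nat \/ p ord0 k = M :> nat) -> U p = 0.

Definition interior {M : nat} (p : node M) : Prop :=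
  forall k : 'I_3, (0 < p ord0 k < M)%N.

Definition to_lattice {M : nat} (p : node M) : 'rV[int]_3 :=
  \row_k (p ord0 k : nat)%:Z.

Definition unitv (k : 'I_3) : 'rV[int]_3 := delta_mx ord0 k.

(* Extension by zero to the lattice Z^3, hence to the ghost nodes. *)
Definition ext {R : realType} {M : nat} (U : gridfun R M) (x : 'rV[int]_3) : R :=
  if [forall k, 0 <= x ord0 k <= M%:Z] then U (\row_k inord `|x ord0 k|%N) else 0.

(* Meaningful only at the nodes with [p ord0 k < M]: the value at [p] is the
   difference quotient along the edge from [p] to [p + e_k]. *)
Definition Dplus {R : realType} {M : nat} (h : R) (k : 'I_3) (U : gridfun R M) :
    gridfun R M :=
  [ffun p => (ext U (to_lattice p + unitv k) - ext U (to_lattice p)) / h].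

(* On a composite [Dc h k (Dc h l U)] the outer operator also extends
   [Dc h l U] by zero, but at interior nodes it only reads values at genuine
   nodes. There [Dc h l U] uses the ghost values of [U] itself. *)
Definition Dc {R : realType} {M : nat} (h : R) (k : 'I_3) (U : gridfun R M) :
    gridfun R M :=
  [ffun p => (ext U (to_lattice p + unitv k) - ext U (to_lattice p - unitv k))
             / (2 * h)].

Definition lap {R : realType} {M : nat} (h : R) (U : gridfun R M) : gridfun R M :=
  [ffun p => \sum_(k < 3)
     (ext U (to_lattice p + unitv k) - 2 * ext U (to_lattice p)
      + ext U (to_lattice p - unitv k)) / h ^+ 2].

Definition inner {R : realType} {M : nat} (h : R) (U V : gridfun R M) : R :=
  h ^+ 3 * \sum_p U p * V p.

Definition norm2 {R : realType} {M : nat} (h : R) (U : gridfun R M) : R :=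
  inner h U U.

Definition grad_norm2 {R : realType} {M : nat} (h : R) (U : gridfun R M) : R :=
  \sum_(k < 3)
    h ^+ 3 * \sum_(p : 'rV['I_M.+1]_3 | (p ord0 k < M)%N) Dplus h k U p ^+ 2.

Notation tensor R M := 'M[{ffun 'rV['I_M.+1]_3 -> R}]_3.

Definition in_Sh {R : realType} {M : nat} (Q : tensor R M) : Prop :=
  [/\ forall i j, dirichlet (Q i j), Q^T = Q & \tr Q = 0].

Definition tensor_grad_norm2 {R : realType} {M : nat} (h : R) (Q : tensor R M) : R :=
  \sum_(i < 3) \sum_(j < 3) grad_norm2 h (Q i j).

Definition at_node {R : realType} {M : nat} (Q : tensor R M) (p : node M) : 'M[R]_3 :=
  \matrix_(i, j) Q i j p.

Definition nonlin {R : realType} (a b c : R) (A : 'M[R]_3) : 'M[R]_3 :=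
  - (a *: A) + b *: (A ^+ 2 - (3^-1 * \tr (A ^+ 2)) *: 1%:M)
  - (c * \tr (A ^+ 2)) *: A.

Definition nonlin_h {R : realType} {M : nat} (a b c : R) (Q : tensor R M)
    (i j : 'I_3) : gridfun R M :=
  [ffun p => nonlin a b c (at_node Q p) i j].

Definition Fbulk {R : realType} (a b c : R) (A : 'M[R]_3) : R :=
  a / 2 * \tr (A ^+ 2) - b / 3 * \tr (A ^+ 3) + c / 4 * \tr (A ^+ 2) ^+ 2.

Definition E1h {R : realType} {M : nat} (a b c h : R) (Q : tensor R M) : R :=
  inner h [ffun p => Fbulk a b c (at_node Q p)] [ffun => 1].

Definition Eel {R : realType} {M : nat} (L1 L2 L3 h : R) (Q : tensor R M) : R :=
  L1 / 2 * tensor_grad_norm2 h Q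
  + (L2 + L3) / 2 * \sum_(i < 3) norm2 h (\sum_(k < 3) Dc h k (Q i k)).

Definition Eh {R : realType} {M : nat} (L1 L2 L3 h : R) (Q : tensor R M) (s : R) : R :=
  Eel L1 L2 L3 h Q + s.

Definition gfac {R : realType} {M : nat} (a b c h : R) (Q : tensor R M) (s : R) : R :=
  expR s / expR (E1h a b c h Q).

Definition Dch {R : realType} {M : nat} (h : R) (Q : tensor R M) (i j : 'I_3) :
    gridfun R M :=
  [ffun p =>
     \sum_(k < 3) (Dc h j (Dc h k (Q i k)) p + Dc h i (Dc h k (Q j k)) p)
     - 2 / 3 * (\sum_(k < 3) \sum_(l < 3) Dc h l (Dc h k (Q l k)) p)
       * (i == j)%:R].

Definition dt {R : realType} {M : nat} (tau : R) (Q Q' : tensor R M) (i j : 'I_3) :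
    gridfun R M :=
  [ffun p => (Q' i j p - Q i j p) / tau].

(* [(Q', s')] is a step of the (linearly implicit) scheme from [(Q, s)]; the
   existential [st] is the intermediate value written with a tilde. *)
Definition sESAV1 {R : realType} {M : nat} (a b c L1 L2 L3 h Cstar kappa tau : R)
    (Q : tensor R M) (s : R) (Q' : tensor R M) (s' : R) : Prop :=
  [/\ in_Sh Q',
      forall (i j : 'I_3) (p : node M), interior p ->
        dt tau Q Q' i j p =
          L1 * lap h (Q' i j) p + (L2 + L3) / 2 * Dch h Q' i j p
          + gfac a b c h Q s
            * (nonlin_h a b c Q i j p - kappa * (Q' i j p - Q i j p))
    & exists st : R,
        (st - s) / tau =
          - (gfac a b c h Q s
             * \sum_(i < 3) \sum_(j < 3)
                 inner h (nonlin_h a b c Q i j) (dt tau Q Q' i j))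
        /\ s' = Num.max st (- Cstar - Eel L1 L2 L3 h Q')].

(* Main.v *)
Require Import Defs.
From mathcomp Require Import all_boot all_order all_algebra.
From mathcomp Require Import reals sequences exp.
From mathcomp Require Import ring lra zify.

Set Implicit Arguments.
Unset Strict Implicit.
Unset Printing Implicit Defensive.

Import Order.TTheory GRing.Theory Num.Theory.
Local Open Scope ring_scope.

(** The update of [Q] is linearly implicit in the elastic energy and explicit in
    the bulk force, and the update of [s] charges exactly the work of that
    explicit force. Put [W = Q' - Q] and test the first equation of the scheme
    with [W]. Summation by parts turns the Laplacian and [Dch] into negative
    multiples of the bilinear forms of the two elastic terms at [(Q', W)]
    ([inner_lap], [sum_inner_Dch]); convexity of a square,
    [x ^+ 2 - y ^+ 2 <= 2 * (x * (x - y))], bounds the elastic increment by these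
    forms ([Eel_increment]). What remains is the work [g * <f, W>] of the bulk
    force, which the auxiliary variable gives back, plus the dissipation
    [- (tau^-1 + g * kappa) * <W, W>], which is nonpositive
    ([sESAV1_predictor_stable]).

    So the energy decays when [s'] is the predicted value. When the maximum
    selects the cut-off instead, the new energy equals [- Cstar], and it suffices
    that the previous energy is at least [- Cstar]: after a step the cut-off
    itself guarantees this, and initially it holds because [s] is the true bulk
    energy, which is at least [- Cstar] ([E1h_lower_bound]). *)

(** * Summation by parts on the zero-extended grid *)

Section SummationByParts.
Variables (R : realType) (M : nat).
Implicit Types (U V W : gridfun R M) (h : R) (k : 'I_3).

Lemma to_lattice_inj : injective (@to_lattice M).
Proof.
move=> p q /rowP pq; apply/rowP => k; apply/val_inj => /=.
by have := pq k; rewrite !mxE => -[].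
Qed.

(** Writing the extension as a sum over nodes makes it linear in [U] and removes
    every case distinction at the boundary from the summations by parts. *)
Lemma extE U (x : 'rV[int]_3) :
  ext U x = \sum_q U q * (to_lattice q == x)%:R.
Proof.
rewrite /ext; case: ifPn => [/forallP x_in|x_out].
  set p := (\row_k _ : node M).
  have px : to_lattice p = x.
    apply/rowP => k; rewrite !mxE -[x 0 k]/(x ord0 k).
    by have := x_in k; move: (x ord0 k) => y y_in; rewrite inordK; lia.
  rewrite (bigD1 p) //= px eqxx mulr1 big1 ?addr0 // => q qp.
  by rewrite -px (inj_eq to_lattice_inj) (negbTE qp) mulr0.
rewrite big1 // => q _; case: eqP => [qx|_]; last by rewrite mulr0.
case/negP: x_out; apply/forallP => k; rewrite -qx !mxE.
by have := ltn_ord (q ord0 k); move: (q ord0 k) => y /=; lia.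
Qed.

Lemma ext_to_lattice U (p : node M) : ext U (to_lattice p) = U p.
Proof.
rewrite extE (bigD1 p) //= eqxx mulr1 big1 ?addr0 // => q qp.
by rewrite (inj_eq to_lattice_inj) (negbTE qp) mulr0.
Qed.

Lemma extB U V x : ext (U - V) x = ext U x - ext V x.
Proof.
by rewrite !extE -sumrB; apply: eq_bigr => q _; rewrite !ffunE mulrBl.
Qed.

(** Both sides are the sum of [U q * W p] over the pairs of nodes with
    [q = p + v]. *)
Lemma sum_ext_shift U W (v : 'rV[int]_3) :
  \sum_(p : 'rV['I_M.+1]_3) ext U (to_lattice p + v) * W p =
  \sum_p U p * ext W (to_lattice p - v).
Proof.
under eq_bigr do rewrite extE mulr_suml.
rewrite exchange_big /=; apply: eq_bigr => q _.
rewrite extE mulr_sumr; apply: eq_bigr => p _.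
by rewrite [_ == to_lattice q - v]eq_sym subr_eq mulrAC mulrA.
Qed.

Lemma DcB h k U V : Dc h k (U - V) = Dc h k U - Dc h k V.
Proof. by apply/ffunP => p; rewrite !ffunE !extB; ring. Qed.

Lemma inner_sumr h U (V : 'I_3 -> gridfun R M) :
  inner h U (\sum_j V j) = \sum_j inner h U (V j).
Proof.
rewrite /inner -mulr_sumr exchange_big /=; congr (_ * _).
by apply: eq_bigr => p _; rewrite sum_ffunE mulr_sumr.
Qed.

Lemma inner_suml h (V : 'I_3 -> gridfun R M) W :
  inner h (\sum_j V j) W = \sum_j inner h (V j) W.
Proof.
rewrite /inner -mulr_sumr exchange_big /=; congr (_ * _).
by apply: eq_bigr => p _; rewrite sum_ffunE mulr_suml.
Qed.

(** The shifts by [unitv k] and [- unitv k] are adjoint on all zero-extended grid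
    functions. This generality matters: the lemma is applied to [Dc h l U], which
    does not satisfy the Dirichlet condition even if [U] does. *)
Lemma inner_Dc h k U W : inner h (Dc h k U) W = - inner h U (Dc h k W).
Proof.
rewrite /inner -mulrN -sumrN; congr (_ * _).
have shiftN := sum_ext_shift U W (- unitv k).
have shiftP := sum_ext_shift U W (unitv k).
transitivity ((2 * h)^-1 *
    (\sum_(p : 'rV['I_M.+1]_3) ext U (to_lattice p + unitv k) * W p
     - \sum_(p : 'rV['I_M.+1]_3) ext U (to_lattice p - unitv k) * W p)).
  by rewrite -sumrB mulr_sumr; apply: eq_bigr => p _; rewrite ffunE; ring.
rewrite shiftN shiftP -sumrB mulr_sumr; apply: eq_bigr => p _.
by rewrite ffunE opprK; ring.
Qed.

Lemma dirichlet_not_interior U (p : node M) :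
  dirichlet U -> ~ interior p -> U p = 0.
Proof.
move=> U0 pN; apply: U0.
case: (boolP [exists k, ~~ (0 < p ord0 k < M)%N]) => [/existsP[k kN]|].
  by exists k; have := ltn_ord (p ord0 k); lia.
by rewrite negb_exists => /forallP pI; case: pN => k; have := pI k; rewrite negbK.
Qed.

Definition grad_inner h U V : R :=
  \sum_(k < 3) h ^+ 3 *
    \sum_(p : 'rV['I_M.+1]_3 | (p ord0 k < M)%N) Dplus h k U p * Dplus h k V p.

Lemma ext_outside U k (p : node M) :
  p ord0 k = M :> nat -> ext U (to_lattice p + unitv k) = 0.
Proof.
move=> pk; rewrite /ext; case: ifP => // /forallP /(_ k).
by rewrite !mxE !eqxx /=; lia.
Qed.

(** The shift loses only the products at the first layer of nodes, where [U]
    vanishes. *)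
Lemma dirichletM_shift U W k : dirichlet U ->
  \sum_(p : 'rV['I_M.+1]_3)
     ext U (to_lattice p + unitv k) * ext W (to_lattice p + unitv k) =
  \sum_p U p * W p.
Proof.
move=> U0; pose F : gridfun R M := [ffun p => U p * W p].
have extM x : ext U x * ext W x = ext F x.
  by rewrite /ext; case: ifP => _; rewrite ?mulr0 // ffunE.
transitivity (\sum_(p : 'rV['I_M.+1]_3)
    ext F (to_lattice p + unitv k) * [ffun => 1 : R] p).
  by apply: eq_bigr => p _; rewrite extM ffunE mulr1.
rewrite sum_ext_shift; apply: eq_bigr => p _; rewrite ffunE.
have [pk0|pk_gt0] := posnP (p ord0 k).
  by rewrite U0 ?mul0r //; exists k; left.
rewrite /ext ifT ?ffunE ?mulr1 //; apply/forallP => l; rewrite !mxE eqxx /=.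
have := ltn_ord (p ord0 l).
case: (l =P k) => [->|_] /=; first by move: (p ord0 k) pk_gt0 => y; lia.
by move: (p ord0 l) => y; lia.
Qed.

(** The Dirichlet condition is what discards the edges that leave the grid: at
    the last layer both the boundary value and the ghost value of [U] vanish, so
    the edge sum may be extended to all nodes, where it splits into shifted
    sums. *)
Lemma inner_lap h U W : dirichlet U ->
  inner h (lap h U) W = - grad_inner h U W.
Proof.
move=> U0; rewrite /inner /grad_inner -mulr_sumr -mulrN; congr (_ * _).
under eq_bigr do rewrite ffunE mulr_suml.
rewrite exchange_big /= -sumrN; apply: eq_bigr => k _.
have edges : \sum_(p : 'rV['I_M.+1]_3 | (p ord0 k < M)%N)
      Dplus h k U p * Dplus h k W p = \sum_p Dplus h k U p * Dplus h k W p.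
  rewrite [RHS](bigID (fun p : 'rV['I_M.+1]_3 => (p ord0 k < M)%N)) /=.
  rewrite [X in _ + X]big1 ?addr0 // => p pM.
  have pk : p ord0 k = M :> nat by have := ltn_ord (p ord0 k); lia.
  rewrite ffunE ext_outside // ext_to_lattice U0 ?subrr ?mul0r //.
  by exists k; right.
pose A := \sum_(p : 'rV['I_M.+1]_3) ext U (to_lattice p + unitv k) * W p.
pose B := \sum_(p : 'rV['I_M.+1]_3) ext U (to_lattice p - unitv k) * W p.
pose D := \sum_(p : 'rV['I_M.+1]_3) U p * W p.
have -> : \sum_(p : 'rV['I_M.+1]_3)
    (ext U (to_lattice p + unitv k) - 2 * ext U (to_lattice p)
     + ext U (to_lattice p - unitv k)) / h ^+ 2 * W p
  = (h ^+ 2)^-1 * (A - 2 * D + B).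
  rewrite /A /B /D (mulr_sumr _ _ _ 2) -sumrB -big_split mulr_sumr /=.
  by apply: eq_bigr => p _; rewrite ext_to_lattice; ring.
rewrite edges.
have -> : \sum_p Dplus h k U p * Dplus h k W p
  = (h ^+ 2)^-1 *
    (\sum_(p : 'rV['I_M.+1]_3)
        ext U (to_lattice p + unitv k) * ext W (to_lattice p + unitv k)
     - A - \sum_p U p * ext W (to_lattice p + unitv k) + D).
  rewrite /A /D -!sumrB -big_split mulr_sumr /=.
  by apply: eq_bigr => p _; rewrite !ffunE !ext_to_lattice -exprVn; ring.
rewrite dirichletM_shift //.
have -> : \sum_p U p * ext W (to_lattice p + unitv k) = B.
  by rewrite /B sum_ext_shift opprK.
by rewrite -/D; ring.
Qed.

Lemma sqr_increment (x y : R) : x ^+ 2 - y ^+ 2 <= 2 * (x * (x - y)).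
Proof. by have := sqr_ge0 (x - y); nra. Qed.

Lemma norm2_increment h U V : 0 <= h ->
  norm2 h U - norm2 h V <= 2 * inner h U (U - V).
Proof.
move=> h0; rewrite /norm2 /inner -mulrBr mulrCA ler_wpM2l ?exprn_ge0 //.
rewrite -sumrB mulr_sumr ler_sum // => p _.
by rewrite !ffunE; apply: sqr_increment.
Qed.

Lemma grad_norm2_increment h U V : 0 <= h ->
  grad_norm2 h U - grad_norm2 h V <= 2 * grad_inner h U (U - V).
Proof.
move=> h0; rewrite /grad_norm2 /grad_inner -sumrB mulr_sumr ler_sum // => k _.
rewrite -mulrBr mulrCA ler_wpM2l ?exprn_ge0 //.
rewrite -sumrB mulr_sumr ler_sum // => p _.
apply: le_trans (sqr_increment _ _) _; rewrite le_eqVlt; apply/orP; left.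
by apply/eqP; rewrite !ffunE !extB; ring.
Qed.

End SummationByParts.

(** * The elastic energy and its variation *)

Section Elastic.
Variables (R : realType) (M : nat).
Implicit Types (P Q W : tensor R M) (h : R).

Definition tensor_inner h P Q : R :=
  \sum_(i < 3) \sum_(j < 3) inner h (P i j) (Q i j).

Definition div_h h Q (i : 'I_3) : gridfun R M := \sum_(k < 3) Dc h k (Q i k).

Lemma div_hB h P Q i : div_h h (P - Q) i = div_h h P i - div_h h Q i.
Proof.
by rewrite /div_h -sumrB; apply: eq_bigr => k _; rewrite !mxE DcB.
Qed.

Lemma in_ShB P Q : in_Sh P -> in_Sh Q -> in_Sh (P - Q).
Proof.
move=> [P0 Psym Ptr] [Q0 Qsym Qtr]; split.
- by move=> i j p p_bd; rewrite mxE [X in _ + X]mxE !ffunE P0 // Q0 // subr0.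
- by rewrite linearB /= Psym Qsym.
- by rewrite linearB /= Ptr Qtr subr0.
Qed.

(** Symmetry of [W] makes the two halves of [Dch] contribute equally, and its
    vanishing trace removes the diagonal correction. *)
Lemma sum_inner_Dch h Q W : W^T = W -> \tr W = 0 ->
  tensor_inner h (\matrix_(i, j) Dch h Q i j) W =
  - (2 * \sum_(i < 3) inner h (div_h h Q i) (div_h h W i)).
Proof.
move=> Wsym Wtr.
pose X : gridfun R M :=
  [ffun p => 2 / 3 * \sum_(k < 3) \sum_(l < 3) Dc h l (Dc h k (Q l k)) p].
have Dc_div i j :
    inner h [ffun p => \sum_(k < 3) Dc h j (Dc h k (Q i k)) p] (W i j)
    = - inner h (div_h h Q i) (Dc h j (W i j)).
  rewrite inner_suml -sumrN.
  under [RHS]eq_bigr do rewrite -inner_Dc.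
  rewrite -inner_suml; congr (inner _ _ _).
  by apply/ffunP => p; rewrite ffunE sum_ffunE.
have DchE i j : inner h (Dch h Q i j) (W i j) =
    - inner h (div_h h Q i) (Dc h j (W i j))
    - inner h (div_h h Q j) (Dc h i (W j i))
    - inner h X (W i j) * (i == j)%:R.
  have Wij : W j i = W i j by rewrite -[in RHS]Wsym mxE.
  rewrite -!Dc_div Wij /inner -mulrDr -mulrA -mulrBr -big_split /=.
  rewrite mulr_suml -sumrB; congr (_ * _); apply: eq_bigr => p _.
  by rewrite !ffunE big_split /=; ring.
have trW : \sum_(i < 3) \sum_(j < 3) inner h X (W i j) * (i == j)%:R = 0.
  transitivity (inner h X (\tr W)).
    rewrite /mxtrace inner_sumr; apply: eq_bigr => i _.
    rewrite (bigD1 i) //= eqxx mulr1 big1 ?addr0 // => j ji.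
    by rewrite eq_sym (negbTE ji) mulr0.
  by rewrite Wtr /inner big1 ?mulr0 // => p _; rewrite [X in _ * X]ffunE mulr0.
rewrite /tensor_inner.
under eq_bigr do under eq_bigr do rewrite mxE DchE.
under eq_bigr do rewrite sumrB sumrB.
rewrite sumrB trW subr0 sumrB.
have divW : \sum_(i < 3) \sum_(j < 3) inner h (div_h h Q i) (Dc h j (W i j)) =
    \sum_(i < 3) inner h (div_h h Q i) (div_h h W i).
  by apply: eq_bigr => i _; rewrite -inner_sumr.
rewrite [X in _ - X]exchange_big /=; under [X in X - _]eq_bigr do rewrite sumrN.
by rewrite sumrN !divW; ring.
Qed.

Lemma Eel_ge0 (L1 L2 L3 h : R) Q : 0 <= L1 -> 0 <= L2 + L3 -> 0 <= h ->
  0 <= Eel L1 L2 L3 h Q.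
Proof.
move=> L1_ge0 L23_ge0 h_ge0; have h3_ge0 := exprn_ge0 3 h_ge0.
rewrite /Eel addr_ge0 // mulr_ge0 ?divr_ge0 ?ler0n //.
  rewrite /tensor_grad_norm2 /grad_norm2.
  do 3 (apply: sumr_ge0 => ? _).
  by rewrite mulr_ge0 // sumr_ge0 // => p _; rewrite sqr_ge0.
apply: sumr_ge0 => i _; rewrite /norm2 /inner.
by rewrite mulr_ge0 // sumr_ge0 // => p _; rewrite -expr2 sqr_ge0.
Qed.

(** The right-hand side is minus the elastic part of the scheme tested with
    [P - Q]; it is an inequality because the elastic energy is a convex
    quadratic form taken at the new value [P]. *)
Lemma Eel_increment (L1 L2 L3 h : R) P Q :
  0 <= L1 -> 0 <= L2 + L3 -> 0 <= h -> in_Sh P -> in_Sh Q ->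
  Eel L1 L2 L3 h P - Eel L1 L2 L3 h Q <=
  - (L1 * tensor_inner h (\matrix_(i, j) lap h (P i j)) (P - Q)
     + (L2 + L3) / 2 * tensor_inner h (\matrix_(i, j) Dch h P i j) (P - Q)).
Proof.
move=> L1_ge0 L23_ge0 h_ge0 PSh QSh.
have [_ Wsym Wtr] := in_ShB PSh QSh; have [P0 _ _] := PSh.
rewrite sum_inner_Dch //.
have lapE : tensor_inner h (\matrix_(i, j) lap h (P i j)) (P - Q) =
    - \sum_(i < 3) \sum_(j < 3) grad_inner h (P i j) ((P - Q) i j).
  rewrite -sumrN; apply: eq_bigr => i _; rewrite -sumrN; apply: eq_bigr => j _.
  by rewrite mxE inner_lap.
have grad_le : tensor_grad_norm2 h P - tensor_grad_norm2 h Q <=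
    2 * \sum_(i < 3) \sum_(j < 3) grad_inner h (P i j) ((P - Q) i j).
  rewrite /tensor_grad_norm2 -sumrB mulr_sumr ler_sum // => i _.
  rewrite -sumrB mulr_sumr ler_sum // => j _.
  by rewrite !mxE; apply: grad_norm2_increment.
have div_le :
    \sum_(i < 3) norm2 h (div_h h P i) - \sum_(i < 3) norm2 h (div_h h Q i)
    <= 2 * \sum_(i < 3) inner h (div_h h P i) (div_h h (P - Q) i).
  rewrite -sumrB mulr_sumr ler_sum // => i _.
  by rewrite div_hB; apply: norm2_increment.
rewrite lapE /Eel -!/(div_h _ _ _).
have := ler_wpM2l L1_ge0 grad_le; have := ler_wpM2l L23_ge0 div_le.
rewrite /div_h; lra.
Qed.

End Elastic.

(** * Energy stability *)

Section Scheme.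
Variables (R : realType) (M : nat).
Variables (a b c L1 L2 L3 Cstar kappa tau h : R).
Hypotheses (L1_ge0 : 0 <= L1) (L23_ge0 : 0 <= L2 + L3) (h_ge0 : 0 <= h).
Hypotheses (kappa_ge0 : 0 <= kappa) (tau_gt0 : 0 < tau).
Implicit Types (Q : tensor R M) (s : R).

(** The scheme holds at interior nodes only, but the increment vanishes at the
    others, so it may be tested with the increment over the whole grid. *)
Lemma sESAV1_tested Q s Q' s' : in_Sh Q ->
  sESAV1 a b c L1 L2 L3 h Cstar kappa tau Q s Q' s' ->
  tensor_inner h (Q' - Q) (Q' - Q) / tau =
  L1 * tensor_inner h (\matrix_(i, j) lap h (Q' i j)) (Q' - Q)
  + (L2 + L3) / 2 * tensor_inner h (\matrix_(i, j) Dch h Q' i j) (Q' - Q)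
  + gfac a b c h Q s
    * (tensor_inner h (\matrix_(i, j) nonlin_h a b c Q i j) (Q' - Q)
       - kappa * tensor_inner h (Q' - Q) (Q' - Q)).
Proof.
move=> QSh [Q'Sh step _]; have [W0 _ _] := in_ShB Q'Sh QSh.
rewrite /tensor_inner mulr_suml !mulr_sumr -sumrB mulr_sumr -!big_split /=.
apply: eq_bigr => i _.
rewrite mulr_suml !mulr_sumr -sumrB mulr_sumr -!big_split /=.
apply: eq_bigr => j _.
rewrite /inner ![_ * (h ^+ 3 * _)]mulrCA -mulrBr [gfac _ _ _ _ _ _ * _]mulrCA.
rewrite -mulrA -!mulrDr; congr (_ * _).
rewrite mulr_suml !mulr_sumr -sumrB mulr_sumr -!big_split /=.
apply: eq_bigr => p _.
case: (boolP [forall k, (0 < p ord0 k < M)%N]) => [/forallP pI|pN].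
  have WE : (Q' - Q) i j p = Q' i j p - Q i j p by rewrite !mxE !ffunE.
  have := step i j p pI; rewrite {1}/dt ffunE -WE => stepE.
  by rewrite mulrAC stepE ![(\matrix_(_, _) _) i j]mxE; ring.
rewrite (dirichlet_not_interior (W0 i j)) ?(mulr0, mul0r, addr0, subr0) //.
by move=> pI; case/forallP: pN.
Qed.

(** The predictor [st] gives back exactly the work of the explicit bulk force,
    so the elastic increment is left with the dissipation of the scheme. *)
Lemma sESAV1_predictor_stable Q s Q' s' st : in_Sh Q ->
  sESAV1 a b c L1 L2 L3 h Cstar kappa tau Q s Q' s' ->
  (st - s) / tau =
    - (gfac a b c h Q s
       * \sum_(i < 3) \sum_(j < 3)
           inner h (nonlin_h a b c Q i j) (dt tau Q Q' i j)) ->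
  Eh L1 L2 L3 h Q' st <= Eh L1 L2 L3 h Q s.
Proof.
move=> QSh step stE; have [Q'Sh _ _] := step.
have tau_neq0 : tau != 0 by rewrite gt_eqF.
have tested := sESAV1_tested QSh step.
have elastic := Eel_increment L1_ge0 L23_ge0 h_ge0 Q'Sh QSh.
have workE : \sum_(i < 3) \sum_(j < 3)
      inner h (nonlin_h a b c Q i j) (dt tau Q Q' i j) =
    tensor_inner h (\matrix_(i, j) nonlin_h a b c Q i j) (Q' - Q) / tau.
  rewrite /tensor_inner mulr_suml; apply: eq_bigr => i _.
  rewrite mulr_suml; apply: eq_bigr => j _.
  rewrite /inner -mulrA mulr_suml; congr (_ * _); apply: eq_bigr => p _.
  by rewrite !mxE !ffunE mulrA.
have incr : st - s = - (gfac a b c h Q s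
    * tensor_inner h (\matrix_(i, j) nonlin_h a b c Q i j) (Q' - Q)).
  by rewrite -[LHS](divfK tau_neq0) stE workE; field.
have N_ge0 : 0 <= tensor_inner h (Q' - Q) (Q' - Q).
  do 2 (apply: sumr_ge0 => ? _).
  by rewrite mulr_ge0 ?exprn_ge0 // sumr_ge0 // => p _; rewrite -expr2 sqr_ge0.
have Ntau_ge0 := divr_ge0 N_ge0 (ltW tau_gt0).
have g_ge0 : 0 <= gfac a b c h Q s by rewrite divr_ge0 ?expR_ge0.
have gkN_ge0 := mulr_ge0 g_ge0 (mulr_ge0 kappa_ge0 N_ge0).
rewrite /Eh; lra.
Qed.

(** The cut-off value of [s'] is the one for which the new energy equals
    [- Cstar], whence the assumption on the previous energy. *)
Lemma sESAV1_stable Q s Q' s' : in_Sh Q ->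
  - Cstar <= Eh L1 L2 L3 h Q s ->
  sESAV1 a b c L1 L2 L3 h Cstar kappa tau Q s Q' s' ->
  Eh L1 L2 L3 h Q' s' <= Eh L1 L2 L3 h Q s.
Proof.
move=> QSh low step; have [_ _ [st [stE ->]]] := step.
have predicted := sESAV1_predictor_stable QSh step stE.
rewrite {1}/Eh -lerBrDl ge_max !lerBrDl; apply/andP; split; first exact: predicted.
by rewrite addrC subrK.
Qed.

Lemma sESAV1_lower_bound Q s Q' s' :
  sESAV1 a b c L1 L2 L3 h Cstar kappa tau Q s Q' s' ->
  - Cstar <= Eh L1 L2 L3 h Q' s'.
Proof.
by move=> [_ _ [st [_ ->]]]; rewrite /Eh -lerBlDl le_max lexx orbT.
Qed.

End Scheme.

Lemma at_node_in_Sh (R : realType) (M : nat) (Q : tensor R M) (p : node M) :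
  in_Sh Q -> (at_node Q p)^T = at_node Q p /\ \tr (at_node Q p) = 0.
Proof.
move=> [_ Qsym Qtr]; split.
  by apply/matrixP => i j; rewrite !mxE -[in LHS]Qsym mxE.
have := congr1 (fun U : gridfun R M => U p) Qtr.
rewrite /mxtrace sum_ffunE ffunE => Qtr_p.
by rewrite -[RHS]Qtr_p; apply: eq_bigr => i _; rewrite mxE.
Qed.

Lemma card_interior_le (M : nat) : (0 < M)%N ->
  (#|[pred p : 'rV['I_M.+1]_3 | [forall k, 0 < p ord0 k < M]]| <= M ^ 3)%N.
Proof.
case: M => // M _.
pose f (p : 'rV['I_M.+2]_3) : 'rV['I_M.+1]_3 := \row_k inord (p ord0 k).
have -> : (M.+1 ^ 3 = #|{: 'rV['I_M.+1]_3}|)%N by rewrite card_mx card_ord.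
apply: (@leq_card_in _ _ f) => p q; rewrite !inE => /forallP pI /forallP qI.
move=> /rowP fpq; apply/rowP => k; apply/val_inj => /=.
have /andP[_ pk] := pI k; have /andP[_ qk] := qI k.
by have := congr1 val (fpq k); rewrite !mxE /= !inordK.
Qed.

(** The bulk density vanishes at boundary nodes, so only the [(M - 1) ^ 3]
    interior nodes, each with weight [(Ld / M) ^ 3], count: their total weight
    does not exceed that of the domain. *)
Lemma E1h_lower_bound (R : realType) (a b c Ld Cstar : R) (M : nat)
    (Q : tensor R M) : (0 < M)%N -> 0 <= Cstar ->
  (forall A : 'M[R]_3, A^T = A -> \tr A = 0 ->
     - Cstar <= Ld ^+ 3 * Fbulk a b c A) ->
  in_Sh Q -> - Cstar <= E1h a b c (Ld / M%:R) Q.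
Proof.
move=> M_gt0 C_ge0 F_ge QSh.
have M3_gt0 : 0 < M%:R ^+ 3 :> R by rewrite exprn_gt0 // ltr0n.
pose I := [pred p : 'rV['I_M.+1]_3 | [forall k, (0 < p ord0 k < M)%N]].
have F0 p : p \notin I -> Fbulk a b c (at_node Q p) = 0.
  move=> pN; have -> : at_node Q p = 0.
    apply/matrixP => i j; rewrite !mxE; have [Q0 _ _] := QSh.
    by apply: dirichlet_not_interior => // pI; case/forallP: pN.
  by rewrite /Fbulk !expr0n /= !mxtrace0; ring.
have cell p : - (Cstar / M%:R ^+ 3) <=
    (Ld / M%:R) ^+ 3 * Fbulk a b c (at_node Q p).
  have [Asym Atr] := at_node_in_Sh p QSh.
  rewrite expr_div_n mulrAC -mulNr.
  by apply: ler_wpM2r; [rewrite invr_ge0 ltW | apply: F_ge].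
rewrite /E1h /inner mulr_sumr (bigID (mem I)) /= [X in _ + X]big1 ?addr0; last first.
  by move=> p pN; rewrite ffunE F0 // mul0r mulr0.
have : \sum_(p in I) - (Cstar / M%:R ^+ 3) <=
   \sum_(p in I) (Ld / M%:R) ^+ 3 *
     ([ffun p => Fbulk a b c (at_node Q p)] p * [ffun => 1 : R] p).
  by apply: ler_sum => p _; rewrite !ffunE mulr1; apply: cell.
apply: le_trans; rewrite sumr_const mulNrn lerN2 -[_ *+ #|_|]mulr_natr mulrAC.
rewrite ler_pdivrMr // ler_wpM2l // -natrX ler_nat.
exact: card_interior_le.
Qed.

Theorem theorem3p1 (R : realType) (a b c L1 L2 L3 Ld Cstar kappa tau : R) (M : nat)
  (hb : 0 <= b) (hc : 0 < c)
  (hL1 : 0 < L1) (hL2 : 0 < L2) (hL3 : 0 < L3)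
  (hLd : 0 < Ld) (hM : (0 < M)%N)
  (hCstar : 0 < Cstar)
  (hFbulk : forall A : 'M[R]_3, A^T = A -> \tr A = 0 ->
     - Cstar <= Ld ^+ 3 * Fbulk a b c A)
  (hkappa : 0 <= kappa) (htau : 0 < tau)
  (Q : nat -> tensor R M) (s : nat -> R)
  (hQ0 : in_Sh (Q 0%N))
  (hs0 : s 0%N = E1h a b c (Ld / M%:R) (Q 0%N))
  (hscheme : forall n : nat,
     sESAV1 a b c L1 L2 L3 (Ld / M%:R) Cstar kappa tau
       (Q n) (s n) (Q n.+1) (s n.+1)) :
  forall n : nat,
    Eh L1 L2 L3 (Ld / M%:R) (Q n.+1) (s n.+1) <= Eh L1 L2 L3 (Ld / M%:R) (Q n) (s n).
Proof.
move=> n.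
have h_ge0 : 0 <= Ld / M%:R by rewrite divr_ge0 ?ler0n // ltW.
have L23_ge0 : 0 <= L2 + L3 by rewrite addr_ge0 ?ltW.
have QSh m : in_Sh (Q m) by case: m => [//|m]; have [] := hscheme m.
apply: (sESAV1_stable (ltW hL1) L23_ge0 h_ge0 hkappa htau (QSh n) _ (hscheme n)).
case: n => [|n]; last exact: sESAV1_lower_bound (hscheme n).
rewrite /Eh hs0; apply: le_trans (E1h_lower_bound hM (ltW hCstar) hFbulk hQ0) _.
by rewrite lerDr; apply: Eel_ge0 => //; apply: ltW.
Qed.
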